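(* Let $q_0,q_1,q_2,q_3$ be real polynomials in one variable such that $q_0(0)=0$, $q_0'(0)=1$, $q_1(0)=0$, and $q_3$ is not identically zero. The vector field of the system $$\dot x = -y, \qquad \dot y = q_0(x) + 3 q_1(x) y + q_2(x) y^2 + q_3(x) y^3$$ commutes with some transversal polynomial vector field if and only if the following two identities hold: $$q_2 q_0 = 3 q_1^2 - q_0' + 1, \qquad q_3 q_0^2 = q_1^3 - q_1' q_0 + q_1 .$$
   Context: Two planar vector fields $(p,q)$ and $(r,s)$ commute if their Lie bracket vanishes identically, i.e. $$r p_x + s p_y - p r_x - q r_y = 0, \qquad r q_x + s q_y - p s_x - q s_y = 0.$$ Two vector fields are transversal at a point if their values there are linearly independent. A polynomial field is called transversal to the given one if it is transversal to it at every point of some punctured neighborhood of the origin. Primes denote derivatives with respect to $x$. *)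

(* Defs.v *)
From HB Require Import structures.
From mathcomp Require Import all_boot all_order all_algebra.
From mathcomp Require Import all_classical all_reals all_analysis.

Set Implicit Arguments.
Unset Strict Implicit.
Unset Printing Implicit Defensive.

Import Order.TTheory GRing.Theory Num.Theory.
Import numFieldNormedType.Exports.
Local Open Scope classical_set_scope.
Local Open Scope ring_scope.

(* Real polynomials in (x, y) are elements of R[x][y] = {poly {poly R}}: the  *)
(* outer variable 'X is y, the inner one 'X%:P is x, and q(x) is q%:P.        *)

Definition partial_x (R : realType) (f : {poly {poly R}}) : {poly {poly R}} :=
  map_poly (@deriv R) f.

Definition partial_y (R : realType) (f : {poly {poly R}}) : {poly {poly R}} :=
  deriv f.

Definition eval2 (R : realType) (f : {poly {poly R}}) (z : R * R) : R :=
  f.[z.2%:P].[z.1].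

(* (p, q) stands for the field p d/dx + q d/dy. *)
Definition poly_field (R : realType) : Type :=
  ({poly {poly R}} * {poly {poly R}})%type.

Definition field_at (R : realType) (V : poly_field R) (z : R * R)
  : R^o * R^o := (eval2 V.1 z, eval2 V.2 z).

(* A real polynomial vanishing at every point is the zero polynomial, so the  *)
(* bracket vanishes identically iff its components are 0 in R[x][y].          *)
Definition commute_fields (R : realType) (V W : poly_field R) : Prop :=
  let: (p, q) := V in let: (r, s) := W in
  r * partial_x p + s * partial_y p - p * partial_x r - q * partial_y r = 0
  /\
  r * partial_x q + s * partial_y q - p * partial_x s - q * partial_y s = 0.

Definition transversal_at (R : realType) (V W : poly_field R) (z : R * R)
  : Prop := free [:: field_at V z; field_at W z].

Definition transversal_fields (R : realType) (V W : poly_field R) : Prop :=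
  \forall z \near ((0, 0) : R * R)^', transversal_at V W z.

Definition cubic_field (R : realType) (q0 q1 q2 q3 : {poly R})
  : poly_field R :=
  (- 'X, q0%:P + 3 * q1%:P * 'X + q2%:P * 'X^2 + q3%:P * 'X^3).

(* Main.v *)
Require Import Defs.
From HB Require Import structures.
From mathcomp Require Import all_boot all_order all_algebra.
From mathcomp Require Import all_classical all_reals all_analysis.
From mathcomp Require Import zify ring lra.
Import Order.TTheory GRing.Theory Num.Theory.
Import numFieldNormedType.Exports.
Local Open Scope ring_scope.

(* For a field (r, s) commuting with (-y, Q), the first bracket equation gives
   s = y r_x - Q r_y, and the second becomes a single equation for r.  Its
   leading coefficient in y shows, since q3 <> 0, that r has degree at most 1
   in y, so r = a(x) + b(x) y.  The remaining coefficients in y say that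
   a q0' = q0 a', a q1' = q0 b', and two further equations.  Hence a = c q0, and
   transversality forces c <> 0 (otherwise b is constant and (r, s) is
   proportional to (-y, Q)), so b' = c q1' and the last two equations integrate
   to the two identities, the constants being fixed by the values at 0.
   Conversely r = q0 + q1 y works: by the first identity its determinant with
   (-y, Q) is, up to sign,
   (q0 + 3/2 q1 y)^2 + 3/4 q1^2 y^2 + y^2 (1 + y (q1' + q3 q0)),
   which is positive near the origin except at the origin itself. *)

(** * Polynomials in one variable: leading terms, derivatives and Wronskians *)

Lemma coef_mul_top {R : nzRingType} {f g : {poly R}} {i j : nat} :
  (size f <= i.+1)%N -> (size g <= j.+1)%N -> (f * g)`_(i + j) = f`_i * g`_j.
Proof.
move=> fi gj; have ij : (i < (i + j).+1)%N by rewrite ltnS leq_addr.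
rewrite coefM (bigD1 (Ordinal ij)) //= addKn big1 ?addr0 // => k ki.
have [ik|ik] := ltnP i k.
  by rewrite (nth_default _ (leq_trans fi ik)) mul0r.
have {}ki : (k < i)%N by rewrite ltn_neqAle ik andbT; apply: contra ki.
rewrite [g`__]nth_default ?mulr0 //.
by apply: leq_trans gj _; lia.
Qed.

Lemma deriv_eq0_const {R : numDomainType} {p : {poly R}} :
  p^`() = 0 -> p = p.[0]%:P.
Proof.
move=> dp; rewrite horner_coef0; apply/polyP => -[|i]; rewrite coefC //=.
have := congr1 (fun f : {poly R} => f`_i) dp.
by rewrite coef_deriv coef0 => /eqP; rewrite mulrn_eq0 => /eqP.
Qed.

(** Comparing top coefficients shows that two nonzero polynomials with zero Wronskian have equal
    degree. Removing from [p] the multiple of [q] with the same leading term keeps the Wronskian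
    with [q] zero but lowers the degree, so nothing is left. *)
Lemma wronskian_eq0_proportional {R : numFieldType} {p q : {poly R}} :
  q != 0 -> p * q^`() = q * p^`() -> exists c, p = c%:P * q.
Proof.
(* Multiplying by 'X keeps the degrees free of truncated subtraction. *)
have coefXderiv (f : {poly R}) k : ('X * f^`())`_k = f`_k *+ k.
  by case: k => [|k]; rewrite coefXM ?mulr0n //= coef_deriv.
have size_eq (f g : {poly R}) : f != 0 -> g != 0 ->
    f * g^`() = g * f^`() -> size f = size g.
  move=> f0 g0 e.
  have [m fm] : exists m, size f = m.+1.
    by exists (size f).-1; rewrite prednK // size_poly_gt0.
  have [n gn] : exists n, size g = n.+1.
    by exists (size g).-1; rewrite prednK // size_poly_gt0.
  have sXd (h : {poly R}) k : size h = k.+1 -> (size ('X * h^`())%R <= k.+1)%N.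
    move=> hk; apply/leq_sizeP => j kj.
    by rewrite coefXderiv nth_default ?mul0rn // hk.
  have top : ('X * (f * g^`()))`_(m + n) = ('X * (g * f^`()))`_(m + n).
    by rewrite e.
  rewrite mulrCA [in RHS]mulrCA [in RHS](addnC m n) in top.
  rewrite !coef_mul_top ?fm ?gn ?sXd // !coefXderiv in top.
  rewrite mulrnAr mulrnAr [g`_n * _]mulrC in top.
  have nz : f`_m * g`_n != 0.
    rewrite mulf_neq0 //.
    - by rewrite -[m]/(m.+1.-1) -fm -lead_coefE lead_coef_eq0.
    - by rewrite -[n]/(n.+1.-1) -gn -lead_coefE lead_coef_eq0.
  have /eqP : n%:R = m%:R :> R by apply: (mulfI nz); rewrite !mulr_natr.
  by rewrite eqr_nat => /eqP nm; rewrite fm gn nm.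
move=> q0 e; pose c := lead_coef p / lead_coef q.
exists c; apply/eqP; rewrite -subr_eq0; apply/negPn/negP => d0.
have p0 : p != 0.
  by apply: contraNneq d0 => p0; rewrite /c p0 lead_coef0 mul0r polyC0 mul0r subr0.
have spq := size_eq _ _ p0 q0 e.
have sd : size (p - c%:P * q) = size q.
  apply: size_eq => //; rewrite derivB derivM derivC mul0r add0r.
  by rewrite mulrBl mulrBr e; ring.
have : lead_coef (p - c%:P * q) = 0.
  rewrite lead_coefE sd coefB coefCM -[q`__]lead_coefE -spq -lead_coefE /c.
  by rewrite mulfVK ?subrr // lead_coef_eq0.
by move/eqP; rewrite lead_coef_eq0 (negPf d0).
Qed.

(** * Cubics in y, given by their coefficients in x *)

Definition ypoly3 {R : realType} (a b c d : {poly R}) : {poly {poly R}} :=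
  a%:P + b%:P * 'X + c%:P * 'X^2 + d%:P * 'X^3.

Lemma coef_ypoly3 {R : realType} (a b c d : {poly R}) (k : nat) :
  (ypoly3 a b c d)`_k =
  if k is 0 then a else if k is 1 then b else
  if k is 2 then c else if k is 3 then d else 0.
Proof.
rewrite /ypoly3 !coefD !coefCM !coefC !coefX !coefXn.
by case: k => [|[|[|[|k]]]]; rewrite /= ?mulr1 ?mulr0 ?addr0 ?add0r.
Qed.

Lemma ypoly3_eq0 {R : realType} (a b c d : {poly R}) :
  ypoly3 a b c d = 0 <-> [/\ a = 0, b = 0, c = 0 & d = 0].
Proof.
split=> [e|[-> -> -> ->]]; last by rewrite /ypoly3 !mul0r !addr0.
by split; [have := coef_ypoly3 a b c d 0 | have := coef_ypoly3 a b c d 1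
  | have := coef_ypoly3 a b c d 2 | have := coef_ypoly3 a b c d 3];
  rewrite e coef0.
Qed.

Lemma partial_x_ypoly3 {R : realType} (a b c d : {poly R}) :
  partial_x (ypoly3 a b c d) = ypoly3 a^`() b^`() c^`() d^`().
Proof.
apply/polyP => k; rewrite /partial_x coef_map !coef_ypoly3 /=.
by case: k => [|[|[|[|k]]]] //; exact: deriv0.
Qed.

Lemma partial_y_ypoly3 {R : realType} (a b c d : {poly R}) :
  partial_y (ypoly3 a b c d) = ypoly3 b (c *+ 2) (d *+ 3) 0.
Proof.
apply/polyP => k; rewrite /partial_y coef_deriv !coef_ypoly3 /=.
by case: k => [|[|[|[|k]]]] //; rewrite ?mul0rn.
Qed.

Lemma cubic_fieldE {R : realType} (q0 q1 q2 q3 : {poly R}) :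
  cubic_field q0 q1 q2 q3 = (- 'X, ypoly3 q0 (3 * q1) q2 q3).
Proof. by rewrite /cubic_field /ypoly3; congr pair; ring. Qed.

(** * Commutation with the cubic field *)

Lemma commute_cubicE {R : realType} (q0 q1 q2 q3 : {poly R})
    (r s : {poly {poly R}}) (Q := ypoly3 q0 (3 * q1) q2 q3) :
  commute_fields (cubic_field q0 q1 q2 q3) (r, s) <->
  s = 'X * partial_x r - Q * partial_y r /\
  r * partial_x Q + s * partial_y Q + 'X * partial_x s - Q * partial_y s = 0.
Proof.
rewrite cubic_fieldE -/Q /=.
have -> : partial_x (- 'X : {poly {poly R}}) = 0.
  apply/polyP => k; rewrite /partial_x coef_map coefN coefX coef0.
  by case: eqP => _; rewrite /= derivN ?deriv0 -?polyC1 ?derivC oppr0.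
have -> : partial_y (- 'X : {poly {poly R}}) = -1.
  by rewrite /partial_y derivN derivX.
rewrite mulr0 add0r !mulNr !opprK mulrN1; split=> -[e1 e2]; split=> //.
- by apply/eqP; rewrite -subr_eq0 -oppr_eq0 -[X in _ == X]e1; apply/eqP; ring.
- by rewrite e1; ring.
Qed.

(** Once [s] is substituted, the coefficients of y^4 and y^5 in the second bracket equation cancel,
    so only those of 1, y, y^2 and y^3 give conditions. *)
Lemma commute_cubic_linear {R : realType} (q0 q1 q2 q3 a b : {poly R})
    (s : {poly {poly R}}) :
  commute_fields (cubic_field q0 q1 q2 q3) (ypoly3 a b 0 0, s) <->
  s = ypoly3 (- (b * q0)) (a^`() - 3 * b * q1) (b^`() - b * q2) (- (b * q3)) /\
  [/\ a * q0^`() = q0 * a^`(),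
      a * q1^`() = q0 * b^`(),
      a^`()^`() - 6 * q1 * b^`() + a^`() * q2 + a * q2^`() = 0 &
      b^`()^`() - q2 * b^`() + 2 * q3 * a^`() + a * q3^`() = 0].
Proof.
rewrite commute_cubicE partial_x_ypoly3 !partial_y_ypoly3 !deriv0 partial_x_ypoly3.
have -> : 'X * ypoly3 a^`() b^`() 0 0 -
    ypoly3 q0 (3 * q1) q2 q3 * ypoly3 b (0 *+ 2) (0 *+ 3) 0 =
  ypoly3 (- (b * q0)) (a^`() - 3 * b * q1) (b^`() - b * q2) (- (b * q3)).
  by rewrite /ypoly3 !mul0rn; ring.
have d3 : (3 : {poly R})^`() = 0 by rewrite -polyC_natr derivC.
suff key : forall t, t = ypoly3 (- (b * q0)) (a^`() - 3 * b * q1)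
      (b^`() - b * q2) (- (b * q3)) ->
    ypoly3 a b 0 0 * ypoly3 q0^`() (3 * q1)^`() q2^`() q3^`() +
      t * ypoly3 (3 * q1) (q2 *+ 2) (q3 *+ 3) 0 +
    'X * partial_x t - ypoly3 q0 (3 * q1) q2 q3 * partial_y t =
    ypoly3 (a * q0^`() - q0 * a^`()) (3 * (a * q1^`() - q0 * b^`()))
      (a^`()^`() - 6 * q1 * b^`() + a^`() * q2 + a * q2^`())
      (b^`()^`() - q2 * b^`() + 2 * q3 * a^`() + a * q3^`()).
  split=> -[es]; rewrite (key _ es).
    move/ypoly3_eq0 => [/subr0_eq E0 /eqP E1 E2 E3]; split=> //; split=> //.
    move: E1; rewrite mulf_eq0 -polyC_natr polyC_eq0 pnatr_eq0 /= subr_eq0.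
    by move/eqP.
  move=> [E0 E1 E2 E3]; split=> //; apply/ypoly3_eq0.
  by rewrite E0 E1 E2 E3 !subrr mulr0.
move=> t ->; rewrite partial_x_ypoly3 partial_y_ypoly3 !derivN !derivB !derivM.
by rewrite d3 /ypoly3; ring.
Qed.

(* If r has degree n in y, the coefficient of y^(n+4) in the commutation
   equation is n (n - 1) q3^2 r_n. *)
Lemma commute_cubic_linear_in_y {R : realType} {q0 q1 q2 q3 : {poly R}}
    {r s : {poly {poly R}}} :
  q3 != 0 -> commute_fields (cubic_field q0 q1 q2 q3) (r, s) ->
  exists a b, r = ypoly3 a b 0 0.
Proof.
move=> q3_neq0; rewrite commute_cubicE; set Q := ypoly3 _ _ _ _ => -[es e].
have [rle|rgt] := leqP (size r) 2.
  exists r`_0, r`_1; apply/polyP => k; rewrite coef_ypoly3.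
  by case: k => [|[|[|[|k]]]] //; rewrite nth_default // (leq_trans rle).
(* Here the degree of [r] in y is n + 2, so the coefficient to inspect is that of y^(n+6) and the
   numerical factor is (n + 2)(n + 1), never zero. *)
have [n rn] : exists n, size r = n.+3 by exists (size r - 3)%N; lia.
have szx (f : {poly {poly R}}) k : (size f <= k)%N -> (size (partial_x f) <= k)%N.
  move=> fk; apply/leq_sizeP => j kj; rewrite /partial_x coef_map /=.
  by rewrite nth_default ?deriv0 // (leq_trans fk).
have szy (f : {poly {poly R}}) k : (size f <= k.+1)%N -> (size (partial_y f) <= k)%N.
  move=> fk; apply/leq_sizeP => j kj; rewrite /partial_y coef_deriv.
  by rewrite nth_default ?mul0rn // (leq_trans fk).
have szQ : (size Q <= 4)%N.
  by apply/leq_sizeP => j; rewrite coef_ypoly3; case: j => [|[|[|[|]]]].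
have szM (f g : {poly {poly R}}) i j : (size f <= i.+1)%N -> (size g <= j.+1)%N ->
    (size (f * g)%R <= (i + j).+1)%N.
  by move=> fi gj; apply: leq_trans (size_polyMleq _ _) _; lia.
have szr : (size r <= n.+3)%N by rewrite rn.
have szs : (size s <= n.+2.+3)%N.
  rewrite es; apply: leq_trans (size_polyD _ _) _; rewrite size_polyN geq_max.
  apply/andP; split.
    have X2 : (size ('X : {poly {poly R}}) <= 2)%N by rewrite size_polyX.
    by have := szM _ _ _ _ X2 (szx _ _ szr); move/leq_trans; apply; lia.
  by have := szM _ _ 3 _ szQ (szy _ _ szr); move/leq_trans; apply; lia.
have s_top : s`_(3 + n.+1) = - (q3 * r`_n.+2 *+ n.+2).
  rewrite es coefB coefXM /= (coef_mul_top szQ (szy _ _ szr)).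
  rewrite /partial_x coef_map /= [r`__]nth_default ?rn // deriv0 sub0r.
  by rewrite /partial_y coef_deriv coef_ypoly3 mulrnAr.
(* Only s Q_y and Q s_y reach y^(n+6): both r Q_x and y s_x have degree at most n + 5 in y. *)
have := congr1 (fun f : {poly {poly R}} => f`_(n.+4.+2)) e.
rewrite coef0 coefB !coefD coefXM /=.
have -> : (r * partial_x Q)`_n.+4.+2 = 0.
  rewrite nth_default //; have := szM _ _ _ 3 szr (szx _ _ szQ).
  by move/leq_trans; apply; lia.
have -> : (partial_x s)`_n.+4.+1 = 0.
  by rewrite nth_default //; apply: szx; apply: leq_trans szs _.
have -> : (s * partial_y Q)`_n.+4.+2 = s`_(3 + n.+1) * (q3 *+ 3).
  have -> : n.+4.+2 = (n.+4 + 2)%N by rewrite addn2.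
  by rewrite (coef_mul_top szs (szy _ _ szQ)) partial_y_ypoly3 coef_ypoly3.
have -> : (Q * partial_y s)`_n.+4.+2 = q3 * (s`_(3 + n.+1) *+ n.+4).
  have -> : n.+4.+2 = (3 + n.+3)%N by [].
  by rewrite (coef_mul_top szQ (szy _ _ szs)) coef_ypoly3 /partial_y coef_deriv.
rewrite s_top add0r addr0 => e_top.
have : q3 * q3 * r`_n.+2 * (n.+2%:R * n.+1%:R) = 0.
  by rewrite -[RHS]e_top; ring.
have nz k : (k.+1%:R : {poly R}) != 0 by rewrite -polyC_natr polyC_eq0 pnatr_eq0.
have rtop : r`_n.+2 != 0.
  by rewrite -[n.+2]/(n.+3.-1) -rn -lead_coefE lead_coef_eq0 -size_poly_gt0 rn.
by move/eqP; rewrite !mulf_eq0 (negPf q3_neq0) (negPf rtop) !(negPf (nz _)).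
Qed.

(** * Transversality as a nonzero determinant, and estimates near the origin *)

Lemma transversal_atE {R : realType} (V W : poly_field R) (z : R * R) :
  transversal_at V W z <->
  eval2 V.1 z * eval2 W.2 z - eval2 V.2 z * eval2 W.1 z != 0.
Proof.
rewrite /transversal_at /field_at free_cons span_seq1 seq1_free.
move: (eval2 V.1 z) (eval2 V.2 z) (eval2 W.1 z) (eval2 W.2 z) => v1 v2 w1 w2.
split=> [/andP[Vnot W0]|det0].
  apply: contraNneq Vnot => /subr0_eq det0; apply/vlineP.
  have [w10|w10] := eqVneq w1 0.
    have w20 : w2 != 0 by apply: contraNneq W0 => w20; rewrite w10 w20.
    have v10 : v1 = 0.
      by move/eqP: det0; rewrite w10 mulr0 mulf_eq0 (negPf w20) orbF => /eqP.
    exists (v2 / w2); rewrite v10 w10; congr pair; rewrite /= /GRing.scale /=.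
    + by rewrite mulr0.
    + by rewrite mulfVK.
  exists (v1 / w1); congr pair; rewrite /= /GRing.scale /= ?mulfVK //.
  by rewrite mulrAC det0 mulfK.
apply/andP; split.
  apply: contraNN det0 => /vlineP[k [-> ->]] /=; rewrite /GRing.scale /=.
  by apply/eqP; ring.
by apply: contraNN det0 => /eqP[-> ->]; rewrite !mulr0 subrr.
Qed.

Lemma dnbhs_ex {R : realType} {P : R * R -> Prop} :
  (\forall z \near ((0, 0) : R * R)^'%classic, P z) -> exists z, P z.
Proof.
move=> /nbhs_ex[d dP]; exists (d%:num / 2, 0); apply: dP.
  split; rewrite /= /ball /= sub0r normrN ?normr0 //.
  by rewrite gtr0_norm // ltr_pdivrMr // ltr_pMr // ltr1n.
by apply/eqP => -[/eqP]; rewrite mulf_eq0 invr_eq0 pnatr_eq0 orbF gt_eqF.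
Qed.

Lemma eval2_ypoly3 {R : realType} (a b c d : {poly R}) (z : R * R) :
  eval2 (ypoly3 a b c d) z =
  a.[z.1] + b.[z.1] * z.2 + c.[z.1] * z.2 ^+ 2 + d.[z.1] * z.2 ^+ 3.
Proof. by rewrite /eval2 /ypoly3 !hornerE. Qed.

Lemma continuous_horner_fst {R : realType} (p : {poly R}) (z : R * R) :
  ((fun t : R * R => p.[t.1]) @ z --> p.[z.1])%classic.
Proof.
apply: (@continuous_comp _ _ _ (fun t : R * R => t.1) (horner p)).
  exact: cvg_fst.
exact: continuous_horner.
Qed.

(** Write q = x u; then u(0) = q'(0) = 1, so u has no zero near 0. *)
Lemma near_simple_root_neq0 {R : realType} (q : {poly R}) :
  q.[0] = 0 -> q^`().[0] = 1 ->
  \forall z \near ((0, 0) : R * R), q.[z.1] = 0 -> z.1 = 0.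
Proof.
move=> q0 dq0; have /factor_theorem[u qE] : root q 0 by apply/rootP.
  rewrite polyC0 subr0 in qE.
have u0 : u.[0] != 0.
  by move: dq0; rewrite qE derivM derivX !hornerE => ->; exact: oner_neq0.
have cu : ((fun t : R * R => u.[t.1]) @ ((0, 0) : R * R) --> u.[0])%classic.
  exact: continuous_horner_fst.
near=> z.
have uz : u.[z.1] != 0.
  by near: z; apply: (cvgr_neq0 _ cu).
by rewrite qE !hornerE => /eqP; rewrite mulf_eq0 (negPf uz) /= => /eqP.
Unshelve. all: by end_near.
Qed.

(** Used with g = q1' + q3 q0, the factor of y^2 in the determinant. *)
Lemma near_add1_mul_gt0 {R : realType} (g : {poly R}) :
  \forall z \near ((0, 0) : R * R), 0 < 1 + z.2 * g.[z.1].
Proof.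
have : ((fun z : R * R => 1 + z.2 * g.[z.1]) @ ((0, 0) : R * R)
          --> 1 + 0 * g.[0 : R])%classic.
  apply: cvgD; first exact: cvg_cst.
  by apply: cvgM; [exact: cvg_snd | exact: continuous_horner_fst].
by move/cvgr_gt; apply; rewrite mul0r addr0 ltr01.
Qed.

Theorem theorem7 (R : realType) (q0 q1 q2 q3 : {poly R})
  (q0_0 : q0.[0] = 0) (dq0_0 : q0^`().[0] = 1) (q1_0 : q1.[0] = 0)
  (q3_neq0 : q3 <> 0) :
  (exists W : poly_field R,
     commute_fields (cubic_field q0 q1 q2 q3) W /\
     transversal_fields (cubic_field q0 q1 q2 q3) W)
  <->
  (q2 * q0 = 3 * q1 ^+ 2 - q0^`() + 1 /\
   q3 * q0 ^+ 2 = q1 ^+ 3 - q1^`() * q0 + q1).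
Proof.
have q0_neq0 : q0 != 0.
  by apply: contra_eq_neq dq0_0 => ->; rewrite deriv0 horner0 eq_sym oner_neq0.
have q3_nz : q3 != 0 by apply/eqP.
have d3 : (3 : {poly R})^`() = 0 by rewrite -polyC_natr derivC.
have h3 x : (3 : {poly R}).[x] = 3 by rewrite -polyC_natr hornerC.
have hornerW := (h3, hornerD, hornerN, hornerM, horner_exp, hornerX, hornerC).
split=> [[[r s] [com trans]]|[I1 I2]].
  have [a [b rE]] := commute_cubic_linear_in_y q3_nz com.
  rewrite {r}rE in com trans.
  move/commute_cubic_linear: com => [sE [E0 E1 E2 E3]].
  have [c aE] := wronskian_eq0_proportional q0_neq0 E0.
  have db : b^`() = c%:P * q1^`().
    by apply: (mulfI q0_neq0); rewrite -E1 aE; ring.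
  have c_neq0 : c%:P != 0 :> {poly R}.
    apply/eqP => c0; rewrite c0 mul0r in aE db.
    (* With a = 0 and b' = 0, (r, s) is -b times the given field; the determinant vanishes
       everywhere, so one point suffices for a contradiction. *)
    have [z /transversal_atE/eqP[]] := dnbhs_ex trans.
    rewrite sE aE db deriv0 cubic_fieldE !eval2_ypoly3 /eval2 /=.
    by rewrite !hornerW; ring.
  have da : a^`() = c%:P * q0^`() by rewrite aE derivM derivC mul0r add0r.
  have dda : a^`()^`() = c%:P * q0^`()^`().
    by rewrite da derivM derivC mul0r add0r.
  have ddb : b^`()^`() = c%:P * q1^`()^`().
    by rewrite db derivM derivC mul0r add0r.
  have I1 : q2 * q0 - (3 * q1 ^+ 2 - q0^`() + 1) = 0.
    rewrite [LHS]deriv_eq0_const.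
      rewrite -[RHS]polyC0; congr polyC.
      by rewrite !hornerW /= q0_0 q1_0 dq0_0; ring.
    (* The left side of [E2] is exactly c times the derivative of the difference of the two sides of
       the first identity. *)
    apply: (mulfI c_neq0); rewrite mulr0 -[RHS]E2 dda db da aE.
    by rewrite !(derivB, derivD, derivM, derivX, derivC, deriv_exp, d3); ring.
  split; first exact: subr0_eq.
  apply: subr0_eq; rewrite [LHS]deriv_eq0_const.
    rewrite -[RHS]polyC0; congr polyC.
    by rewrite !hornerW /= q0_0 q1_0; ring.
  (* Modulo the first identity, q0 is an integrating factor of E3. *)
  apply: (mulfI c_neq0); rewrite mulr0.
  transitivity (q0 * (b^`()^`() - q2 * b^`() + 2 * q3 * a^`() + a * q3^`())
    + c%:P * q1^`() * (q2 * q0 - (3 * q1 ^+ 2 - q0^`() + 1))).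
    rewrite ddb db da aE.
    by rewrite !(derivB, derivD, derivM, derivX, derivC, deriv_exp); ring.
  by rewrite E3 I1 !mulr0 addr0.
(* The solution with c = 1 and b = q1; [s] is then forced by the first bracket equation. *)
exists (ypoly3 q0 q1 0 0, ypoly3 (- (q1 * q0)) (q0^`() - 3 * q1 * q1)
  (q1^`() - q1 * q2) (- (q1 * q3))); split.
  apply/commute_cubic_linear; split=> //; split=> //.
    have := congr1 (@deriv R) I1.
    rewrite !(derivB, derivD, derivM, derivC, deriv_exp, d3).
    by move/eqP; rewrite -subr_eq0 => /eqP dI1; rewrite -[RHS]dI1; ring.
  have := congr1 (@deriv R) I2.
  rewrite !(derivB, derivD, derivM, derivC, deriv_exp).
  (* The integrating factor again: q0 times the last equation is the derivative of the second
     identity minus q1' times the first. *)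
  move/eqP; rewrite -subr_eq0 => /eqP dI2; apply: (mulfI q0_neq0); rewrite mulr0.
  have I1' : q1^`() * (q2 * q0 - (3 * q1 ^+ 2 - q0^`() + 1)) = 0.
    by rewrite I1 subrr mulr0.
  by rewrite -[RHS](subrr 0) -{1}dI2 -I1'; ring.
rewrite /transversal_fields near_withinE; near=> z => z_neq0.
have qz : q0.[z.1] = 0 -> z.1 = 0 by near: z; exact: near_simple_root_neq0.
have gz : 0 < 1 + z.2 * (q1^`() + q3 * q0).[z.1].
  by near: z; exact: near_add1_mul_gt0.
apply/transversal_atE; rewrite cubic_fieldE !eval2_ypoly3 /= /eval2.
have I1z := congr1 (fun p : {poly R} => p.[z.1]) I1.
rewrite !hornerW in I1z gz *.
(* Away from the origin, q0(x) and y cannot both vanish. *)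
have {z_neq0 qz} : q0.[z.1] = 0 -> z.2 <> 0.
  by move=> /qz x0 y0; rewrite [z]surjective_pairing x0 y0 eqxx in z_neq0.
move: q0.[z.1] q1.[z.1] q2.[z.1] q3.[z.1] q0^`().[z.1] q1^`().[z.1] z.2 gz I1z.
move=> a b c d a' b' y pos I1z a0.
have {}I1z : a' = 3 * b ^+ 2 + 1 - c * a by rewrite I1z; ring.
set det := (X in X != 0).
(* The terms in y^4 cancel, and [I1z] turns the y^2 coefficient a' + c a into 3 b^2 + 1; completing
   the square in a^2 + 3 a b y + 3 b^2 y^2 leaves 3/4 (b y)^2. *)
have detE : - det = (a + 3 / 2 * (b * y)) ^+ 2 + 3 / 4 * (b * y) ^+ 2
    + y ^+ 2 * (1 + y * (b' + d * a)).
  by rewrite /det I1z; field.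
apply/eqP => det0; rewrite det0 oppr0 in detE.
have yp : 0 <= y ^+ 2 * (1 + y * (b' + d * a)).
  by rewrite mulr_ge0 ?sqr_ge0 // ltW.
have s1 := sqr_ge0 (a + 3 / 2 * (b * y)); have s2 := sqr_ge0 (b * y).
(* Three nonnegative terms sum to zero: the last gives y = 0, then the first gives a = 0, which [a0]
   excludes. *)
have y0 : y = 0.
  have /eqP : y ^+ 2 * (1 + y * (b' + d * a)) = 0 by lra.
  by rewrite mulf_eq0 (gt_eqF pos) orbF sqrf_eq0 => /eqP.
apply: (a0 _ y0).
have /eqP : (a + 3 / 2 * (b * y)) ^+ 2 = 0 by lra.
by rewrite y0 !mulr0 addr0 sqrf_eq0 => /eqP.
Unshelve. all: by end_near.
Qed.
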